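(* Suppose $\mathcal{Y}=\mathbb{R}^n$, and each $f_i$ is strongly convex with constant $\mu_i>0$ and differentiable with $\nabla f_i$ Lipschitz continuous on $\mathbb{R}^n$ with constant $L_i>0$, $i=1,\dots,m$. Let $\mu=\min_i\mu_i$, $L=\max_iL_i$, $L_h=(1/\mu)(2+2\cos(\pi/m))$, $\mu_h=(1/L)(2-2\cos(\pi/m))$, $h=-g$, and let $\boldsymbol{\lambda}^\star$ be a dual optimal solution, i.e. a maximizer of $g$. Let $\{\boldsymbol{\lambda}^{(k)}\}_{k\ge0}$ be generated by the inexact dual algorithm with distortions satisfying $\|\mathbf{r}_i^{(k)}\|\le\varepsilon_i$ for all $i,k$ and with constant stepsize $\gamma_k=\gamma$ for all $k\ge0$, where $0<\gamma\le1/L_h$. Then for all $k\ge0$, $$h(\boldsymbol{\lambda}^{(k)})-h(\boldsymbol{\lambda}^\star)\le(1-\gamma\mu_h)^k\left(h(\boldsymbol{\lambda}^{(0)})-h(\boldsymbol{\lambda}^\star)\right)+\frac{\epsilon^2}{2\mu_h}.$$ Moreover, $\limsup_k\left(h(\boldsymbol{\lambda}^{(k)})-h(\boldsymbol{\lambda}^\star)\right)\le\epsilon^2/(2\mu_h)$.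
   Context: Let $m\ge2$, $n\ge1$ be integers, $\mathcal{Y}\subseteq\mathbb{R}^n$ a closed convex set, and $f_i:\mathbb{R}^n\to\mathbb{R}$, $i=1,\dots,m$, strictly convex closed functions. For $\mathbf{y}=(\mathbf{y}_1,\dots,\mathbf{y}_m)\in(\mathbb{R}^n)^m=\mathbb{R}^{nm}$ put $f(\mathbf{y})=\sum_{i=1}^m f_i(\mathbf{y}_i)$, let $\bar{\mathcal{Y}}=\mathcal{Y}^m$, and $\mathbf{A}\mathbf{y}=(\mathbf{y}_1-\mathbf{y}_2,\dots,\mathbf{y}_{m-1}-\mathbf{y}_m)\in\mathbb{R}^{n(m-1)}$. The dual function is $g(\boldsymbol{\lambda})=\inf_{\mathbf{y}\in\bar{\mathcal{Y}}}\big[f(\mathbf{y})+\boldsymbol{\lambda}^{T}\mathbf{A}\mathbf{y}\big]$, $\boldsymbol{\lambda}\in\mathbb{R}^{n(m-1)}$. Inexact dual algorithm: start from any $\boldsymbol{\lambda}^{(0)}\in\mathbb{R}^{n(m-1)}$; for $k=0,1,2,\dots$ let $\mathbf{y}^{(k)}=\arg\min_{\mathbf{y}\in\bar{\mathcal{Y}}}\big[f(\mathbf{y})+(\boldsymbol{\lambda}^{(k)})^{T}\mathbf{A}\mathbf{y}\big]$, let $\hat{\mathbf{y}}_i^{(k)}=\mathbf{y}_i^{(k)}+\mathbf{r}_i^{(k)}$ where $\mathbf{r}_i^{(k)}\in\mathbb{R}^n$ are arbitrary distortions, let $\hat{\mathbf{d}}^{(k)}=\mathbf{A}\hat{\mathbf{y}}^{(k)}$,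 and set $\boldsymbol{\lambda}^{(k+1)}=\boldsymbol{\lambda}^{(k)}+\gamma_k\hat{\mathbf{d}}^{(k)}$. The distortions are bounded by constants: $\|\mathbf{r}_i^{(k)}\|\le\varepsilon_i$ for all $i$ and $k$, and $\epsilon:=\sqrt{\sum_{i=1}^{m-1}(\varepsilon_i+\varepsilon_{i+1})^2}$. Norms are Euclidean. A function $\varphi$ is strongly convex with constant $\sigma>0$ if $\varphi-\frac{\sigma}{2}\|\cdot\|^2$ is convex. *)

(* Defs.v *)
From HB Require Import structures.
From mathcomp Require Export all_boot all_order all_algebra.
From mathcomp Require Export all_classical all_reals all_analysis.

Set Implicit Arguments.
Unset Strict Implicit.
Unset Printing Implicit Defensive.

Import Order.TTheory GRing.Theory Num.Theory.
Import numFieldNormedType.Exports.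

Local Open Scope classical_set_scope.
Local Open Scope ring_scope.

(* A vector of (R^q)^p is a matrix whose p rows are its blocks; dot and enorm
   are the Euclidean product and norm of R^(q p). The norm `|_| that the
   library puts on matrices is the sup norm. *)
Definition dot (R : realType) (p q : nat) (u v : 'M[R]_(p, q)) : R :=
  \sum_i \sum_j u i j * v i j.

Definition enorm (R : realType) (p q : nat) (u : 'M[R]_(p, q)) : R :=
  Num.sqrt (dot u u).

Definition strictly_convex (R : realType) (n : nat) (phi : 'rV[R]_n -> R) :=
  forall (x y : 'rV[R]_n) (t : R), x != y -> 0 < t < 1 ->
    phi (t *: x + (1 - t) *: y) < t * phi x + (1 - t) * phi y.

Definition closed_function (R : realType) (n : nat) (phi : 'rV[R]_n -> R) :=
  closed [set p : 'rV[R]_n * R | phi p.1 <= p.2].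

Definition strongly_convex (R : realType) (n : nat) (sigma : R)
    (phi : 'rV[R]_n -> R) :=
  convex_function [set: 'rV[R]_n]
    (fun x => phi x - sigma / 2 * enorm x ^+ 2).

Definition gradient (R : realType) (n : nat) (phi : 'rV[R]_n -> R)
    (x : 'rV[R]_n) : 'rV[R]_n :=
  \row_j 'D_(delta_mx 0 j) phi x.

Definition lipschitz_euclidean (R : realType) (n : nat) (L : R)
    (F : 'rV[R]_n -> 'rV[R]_n) :=
  forall x y : 'rV[R]_n, enorm (F x - F y) <= L * enorm (x - y).

Lemma link_head_subproof (m : nat) (i : 'I_m.-1) : (i < m)%N.
Proof. exact: leq_trans (ltn_ord i) (leq_pred m). Qed.

Lemma link_tail_subproof (m : nat) (i : 'I_m.-1) : (i.+1 < m)%N.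
Proof. by case: m i => [|m] [i]. Qed.

(* The indices i and i + 1 of 'I_m for i among the first m - 1 ones. *)
Definition link_head (m : nat) (i : 'I_m.-1) : 'I_m :=
  Ordinal (link_head_subproof i).

Definition link_tail (m : nat) (i : 'I_m.-1) : 'I_m :=
  Ordinal (link_tail_subproof i).

Section DualProblem.
Context {R : realType} {m n : nat}.
Variables (Y : set 'rV[R]_n) (f : 'I_m -> 'rV[R]_n -> R).

Definition consensus_op (y : 'M[R]_(m, n)) : 'M[R]_(m.-1, n) :=
  \matrix_(i < m.-1) (row (link_head i) y - row (link_tail i) y).

Definition product_set : set 'M[R]_(m, n) := [set y | forall i, Y (row i y)].

Definition lagrangian (lam : 'M[R]_(m.-1, n)) (y : 'M[R]_(m, n)) : R :=
  \sum_i f i (row i y) + dot lam (consensus_op y).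

Definition dual_function (lam : 'M[R]_(m.-1, n)) : \bar R :=
  ereal_inf [set (lagrangian lam y)%:E | y in product_set].

Definition is_argmin (lam : 'M[R]_(m.-1, n)) (y : 'M[R]_(m, n)) :=
  product_set y /\
  forall z, product_set z -> lagrangian lam y <= lagrangian lam z.

Definition dual_optimal (lam : 'M[R]_(m.-1, n)) :=
  forall lam', (dual_function lam' <= dual_function lam)%E.

Definition inexact_dual_algorithm (gamma : nat -> R)
    (lam : nat -> 'M[R]_(m.-1, n)) (y r : nat -> 'M[R]_(m, n)) :=
  forall k, is_argmin (lam k) (y k) /\
    lam k.+1 = lam k + gamma k *: consensus_op (y k + r k).

End DualProblem.

(* Main.v *)
From mathcomp Require Import ring lra.
Require Import Defs.

Set Implicit Arguments.
Unset Strict Implicit.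
Unset Printing Implicit Defensive.

Import Order.TTheory GRing.Theory Num.Theory.
Import numFieldNormedType.Exports.

Local Open Scope classical_set_scope.
Local Open Scope ring_scope.

(** Around its minimiser [y], the Lagrangian at [lam] lies between the quadratics
    with curvatures [mu] and [L]: the lower bound is strong convexity, the upper
    one is the descent lemma, whose linear term vanishes by minimality. Minimising
    these models for the multiplier [lam + d] gives, without computing any
    conjugate, that the negated dual function is smooth along the step and
    satisfies the Polyak-Lojasiewicz inequality, with constants governed by
    [|A^T d|^2 / |d|^2]. This ratio is a Rayleigh quotient of the path Laplacian
    with Dirichlet ends, hence lies in [2 -/+ 2 cos (pi / m)]. Inexact gradient
    descent then contracts the gap [u] as
    [u (k+1) <= (1 - gamma mu_h) u k + gamma eps^2 / 2]. *)

(** * Euclidean product and first-order bounds *)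

Section EuclideanProduct.
Context {R : realType} {p q : nat}.
Implicit Types (u v w : 'M[R]_(p, q)) (a : R).

Lemma dotC u v : dot u v = dot v u.
Proof. by apply: eq_bigr => i _; apply: eq_bigr => j _; rewrite mulrC. Qed.

Lemma dotDl u v w : dot (u + v) w = dot u w + dot v w.
Proof.
rewrite /dot -big_split; apply: eq_bigr => i _ /=.
by rewrite -big_split; apply: eq_bigr => j _; rewrite mxE mulrDl.
Qed.

Lemma dotZl a u v : dot (a *: u) v = a * dot u v.
Proof.
rewrite /dot mulr_sumr; apply: eq_bigr => i _; rewrite mulr_sumr.
by apply: eq_bigr => j _; rewrite mxE mulrA.
Qed.

Lemma dotNl u v : dot (- u) v = - dot u v.
Proof. by rewrite -scaleN1r dotZl mulN1r. Qed.

Lemma dotDr u v w : dot u (v + w) = dot u v + dot u w.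
Proof. by rewrite dotC dotDl !(dotC u). Qed.

Lemma dotZr a u v : dot u (a *: v) = a * dot u v.
Proof. by rewrite dotC dotZl dotC. Qed.

Lemma dotNr u v : dot u (- v) = - dot u v.
Proof. by rewrite dotC dotNl dotC. Qed.

Definition dot_linear := (dotDl, dotDr, dotNl, dotNr, dotZl, dotZr).

Lemma dot_ge0 u : 0 <= dot u u.
Proof. by apply: sumr_ge0 => i _; apply: sumr_ge0 => j _; exact: sqr_ge0. Qed.

Lemma dot_eq0 u : (dot u u == 0) = (u == 0).
Proof.
apply/eqP/eqP => [u0|->]; last first.
  by rewrite /dot big1 // => i _; rewrite big1 // => j _; rewrite mxE mul0r.
apply/matrixP => i j; rewrite mxE; apply/eqP; rewrite -sqrf_eq0 expr2; apply/eqP.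
have row_ge0 k : 0 <= \sum_l u k l * u k l.
  by apply: sumr_ge0 => l _; exact: sqr_ge0.
have /(_ i isT) := psumr_eq0P (fun k _ => row_ge0 k) u0.
by move/psumr_eq0P; apply => // l _; exact: sqr_ge0.
Qed.

Lemma sqr_enorm u : enorm u ^+ 2 = dot u u.
Proof. by rewrite sqr_sqrtr ?dot_ge0. Qed.

Lemma enorm_ge0 u : 0 <= enorm u.
Proof. exact: sqrtr_ge0. Qed.

Lemma enormZ a u : enorm (a *: u) = `|a| * enorm u.
Proof. by rewrite /enorm !dot_linear mulrA -expr2 sqrtrM ?sqr_ge0 // sqrtr_sqr. Qed.

Lemma enormN u : enorm (- u) = enorm u.
Proof. by rewrite -scaleN1r enormZ normrN1 mul1r. Qed.

Lemma cauchy_schwarz u v : dot u v <= enorm u * enorm v.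
Proof.
have [/eqP u0|u0] := eqVneq (enorm u) 0.
  have /eqP -> : u == 0 by rewrite -dot_eq0 -sqr_enorm expf_eq0.
  by rewrite -(scale0r u) dotZl mul0r enormZ normr0 !mul0r.
have [/eqP v0|v0] := eqVneq (enorm v) 0.
  have /eqP -> : v == 0 by rewrite -dot_eq0 -sqr_enorm expf_eq0.
  by rewrite -(scale0r v) dotZr mul0r enormZ normr0 mul0r mulr0.
have uv_gt0 : 0 < enorm u * enorm v by rewrite mulr_gt0 // lt0r ?u0 ?v0 enorm_ge0.
(* This square expands to [2 |u| |v| (|u| |v| - dot u v)], where both norms are now positive. *)
have := dot_ge0 (enorm v *: u - enorm u *: v).
rewrite !dot_linear -!sqr_enorm (dotC v u) => duv.
rewrite -(ler_pM2l uv_gt0); lra.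
Qed.

Lemma enorm_triangle u v : enorm (u + v) <= enorm u + enorm v.
Proof.
rewrite -(@ler_pXn2r _ 2) ?nnegrE ?addr_ge0 ?enorm_ge0 //.
rewrite sqrrD !sqr_enorm !dot_linear (dotC v u).
by have := cauchy_schwarz u v; lra.
Qed.

End EuclideanProduct.

Lemma dot_rows (R : realType) (p q : nat) (u v : 'M[R]_(p, q)) :
  dot u v = \sum_i dot (row i u) (row i v).
Proof.
apply: eq_bigr => i _; rewrite /dot big_ord1.
by apply: eq_bigr => j _; rewrite !mxE.
Qed.

Section FirstOrder.
Context {R : realType} {n : nat}.
Implicit Types (phi : 'rV[R]_n -> R) (x y v : 'rV[R]_n).

(** The convexity defect [t |x|^2 + (1 - t) |y|^2 - |t x + (1 - t) y|^2] of the squared norm is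
    exactly [t (1 - t) |x - y|^2]. *)
Lemma strongly_convex_ineq sigma phi x y (t : R) :
  strongly_convex sigma phi -> 0 <= t <= 1 ->
  phi (t *: x + (1 - t) *: y) <=
    t * phi x + (1 - t) * phi y - sigma / 2 * (t * (1 - t)) * dot (x - y) (x - y).
Proof.
move=> phi_conv /andP[t0 t1].
have := phi_conv (Itv01 t0 t1) x y (in_setT _) (in_setT _).
rewrite !sqr_enorm [X in _ <= X](_ : _ = t * (phi x - sigma / 2 * dot x x) +
  (1 - t) * (phi y - sigma / 2 * dot y y)) // {1 2 3}/conv /= /unstable.onem.
rewrite !dot_linear (dotC y x); lra.
Qed.

(** [gradient] only collects partial derivatives; differentiability makes the directional derivative
    linear in [v], so they determine it. *)
Lemma derive_gradient phi x v :
  differentiable phi x -> 'D_v phi x = dot (gradient phi x) v.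
Proof.
move=> dphi; rewrite deriveE // [in LHS](row_sum_delta v) linear_sum.
rewrite /dot big_ord1; apply: eq_bigr => j _.
by rewrite linearZ mxE deriveE //= mulrC.
Qed.

Lemma is_derive_line phi x v (t : R) :
  differentiable phi (x + t *: v) ->
  is_derive t 1 (fun s : R => phi (x + s *: v)) (dot (gradient phi (x + t *: v)) v).
Proof.
move=> dphi; have dv := diff_derivable (v := v) dphi.
have quotE : (fun h : R => h^-1 *: (((fun s : R => phi (x + s *: v)) \o shift t) (h *: 1)
      - phi (x + t *: v))) =
    (fun h => h^-1 *: ((phi \o shift (x + t *: v)) (h *: v) - phi (x + t *: v))).
  apply/funext => h /=; congr (_ *: (phi _ - _)).
  by rewrite [h *: 1]mulr1 scalerDl addrCA.
split; first by rewrite /derivable quotE.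
by rewrite -derive_gradient // /derive quotE.
Qed.

Lemma descent_lemma (L : R) phi x v :
  (forall z, differentiable phi z) -> 0 < L -> lipschitz_euclidean L (gradient phi) ->
  phi (x + v) <= phi x + dot (gradient phi x) v + L / 2 * dot v v.
Proof.
move=> dphi L_gt0 lip.
(* [psi] is the excess of [phi] over its quadratic model along the segment. Cauchy-Schwarz and the
   Lipschitz bound make [dpsi t] nonpositive for [t > 0], so the mean value theorem gives
   [psi 1 <= psi 0]. *)
pose psi (t : R) := phi (x + t *: v) - (t * dot (gradient phi x) v + t ^+ 2 * (L / 2 * dot v v)).
pose dpsi (t : R) := dot (gradient phi (x + t *: v)) v -
  (dot (gradient phi x) v + (2 * t) * (L / 2 * dot v v)).
have psiD (t : R) : is_derive t 1 psi (dpsi t).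
  have dline := is_derive_line (dphi (x + t *: v)).
  have -> : psi = (fun s : R => phi (x + s *: v)) -
      (dot (gradient phi x) v *: (id : R -> R) + (L / 2 * dot v v) *: ((id : R -> R) ^+ 2)).
    apply/funext => s; rewrite /psi !fctE; congr (_ - (_ + _)); exact: mulrC.
  have did : is_derive t 1 (id : R -> R) 1 by exact: is_derive_id.
  have dlin := is_deriveZ (dot (gradient phi x) v) did.
  have dquad := is_deriveZ (L / 2 * dot v v) (is_deriveX 2 did).
  have dsum := is_deriveB dline (is_deriveD dlin dquad).
  apply: (is_derive_eq dsum).
  rewrite /GRing.scale /= !mulr1 expr1; congr (_ - (_ + _)); exact: mulrC.
have psi_cont : {within `[0, 1], continuous psi}.
  apply: derivable_within_continuous => t _; by case: (psiD t).
have [t] := MVT ltr01 (fun t _ => psiD t) psi_cont.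
rewrite in_itv /= => /andP[t0 t1]; rewrite subr0 mulr1 => psiE.
have dpsi_le0 : dpsi t <= 0.
  have := cauchy_schwarz (gradient phi (x + t *: v) - gradient phi x) v.
  have := lip (x + t *: v) x; rewrite addrAC subrr add0r enormZ gtr0_norm //.
  move=> /(ler_wpM2r (enorm_ge0 v)) + cs; move/(le_trans cs).
  rewrite !dot_linear -!mulrA -expr2 sqr_enorm /dpsi; lra.
move: psiE dpsi_le0; rewrite /psi scale1r scale0r addr0; lra.
Qed.

End FirstOrder.

(** * Spectrum of the path *)

Section PathSpectrum.
Context {R : realType}.

Lemma angle_bounds (m k : nat) : (k < m)%N -> (0 < k)%N ->
  0 < k%:R * (pi / m%:R : R) < pi.
Proof.
move=> km k0; have m0 : 0 < m%:R :> R by rewrite ltr0n (leq_ltn_trans _ km).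
apply/andP; split; first by rewrite mulr_gt0 ?(ltr0n _ k) // divr_gt0 ?pi_gt0.
rewrite mulrCA gtr_pMr ?pi_gt0 //.
by rewrite ltr_pdivrMr // mul1r ltr_nat.
Qed.

(** This three-term recurrence is the eigenvector equation of the path adjacency matrix, with
    eigenvalue [2 cos a]. *)
Lemma sin_angle_rec (k : nat) (a : R) :
  sin (k.+2%:R * a) + sin (k%:R * a) = 2 * cos a * sin (k.+1%:R * a).
Proof.
have -> : k.+2%:R * a = k.+1%:R * a + a by rewrite -[in LHS]natr1 mulrDl mul1r.
have -> : k%:R * a = k.+1%:R * a - a by rewrite -natr1 mulrDl mul1r addrK.
rewrite sinD sinB; ring.
Qed.

Lemma cos_pi_div_bounds (m : nat) : (2 <= m)%N -> 0 <= cos (pi / m%:R : R) < 1.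
Proof.
move=> m2; have m0 : 0 < m%:R :> R by rewrite ltr0n ltnW.
have a0 : 0 < pi / m%:R :> R by rewrite divr_gt0 ?pi_gt0.
apply/andP; split.
  apply: cos_ge0_pihalf; apply/andP; split.
    by rewrite (le_trans _ (ltW a0)) // oppr_le0 divr_ge0 ?pi_ge0.
  by rewrite ler_pM2l ?pi_gt0 // lef_pV2 ?posrE // ler_nat.
(* Cosine 1 would force a zero sine, yet the angle lies strictly between 0 and pi. *)
rewrite lt_neqAle cos_le1 andbT; apply/eqP => c1.
have s0 : 0 < sin (pi / m%:R : R).
  by apply: sin_gt0_pi; have := angle_bounds m2 isT; rewrite mul1r.
by have := exprn_gt0 2 s0; have := cos2Dsin2 (pi / m%:R : R); rewrite c1; lra.
Qed.

(* The weights [sin ((i + 1) pi / m)] form the Perron eigenvector of the path on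
   [m - 1] vertices, so AM-GM with these weights bounds each product of
   neighbours; the last term on the left is what the next product consumes. *)
Lemma path_form_le_aux (m : nat) (x : nat -> R) (k : nat) : (k.+1 < m)%N ->
  2 * (\sum_(i < k) `|x i| * `|x i.+1|) +
    x k ^+ 2 * (sin (k.+2%:R * (pi / m%:R)) / sin (k.+1%:R * (pi / m%:R))) <=
  2 * cos (pi / m%:R) * \sum_(i < k.+1) x i ^+ 2.
Proof.
elim: k => [|k IHk] km.
  have s1 : 0 < sin (1%:R * (pi / m%:R)) :> R by apply/sin_gt0_pi/angle_bounds.
  rewrite big_ord0 mulr0 add0r big_ord1.
  have := sin_angle_rec 0 (pi / m%:R); rewrite mul0r sin0 addr0 => ->.
  by rewrite mulfK ?gt_eqF // mulrC.
have {}IHk := IHk (ltnW km).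
have s1 : 0 < sin (k.+1%:R * (pi / m%:R)) :> R.
  by apply/sin_gt0_pi/angle_bounds => //; exact: ltnW.
have s2 : 0 < sin (k.+2%:R * (pi / m%:R)) :> R by apply/sin_gt0_pi/angle_bounds.
rewrite big_ord_recr [X in _ <= _ * X]big_ord_recr /=.
have -> : sin (k.+3%:R * (pi / m%:R)) = 2 * cos (pi / m%:R) * sin (k.+2%:R * (pi / m%:R))
    - sin (k.+1%:R * (pi / m%:R)) :> R.
  by rewrite -sin_angle_rec addrK.
set s := sin (k.+1%:R * _) in s1 IHk *; set t := sin (k.+2%:R * _) in s2 IHk *.
set c := cos _ in IHk *; set S := \sum_(i < k) _ in IHk *.
set T := \sum_(i < k.+1) _ in IHk *.
have -> : (2 * c * t - s) / t = 2 * c - s / t by rewrite mulrBl mulfK // gt_eqF.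
(* The induction hypothesis provides weight [t / s] on [x k], and the recurrence leaves [s / t] for
   [x k.+1]. *)
have amgm : 2 * (`|x k| * `|x k.+1|) <= x k ^+ 2 * (t / s) + x k.+1 ^+ 2 * (s / t).
  rewrite -(real_normK (num_real (x k))) -(real_normK (num_real (x k.+1))).
  set a := `|x k|; set b := `|x k.+1|.
  rewrite -subr_ge0 (_ : _ - _ = (a * t - b * s) ^+ 2 / (s * t)).
    by rewrite divr_ge0 ?sqr_ge0 // mulr_ge0 // ltW.
  by field; rewrite !gt_eqF.
lra.
Qed.

(** At the last vertex the residual term carries the factor [sin pi = 0]. *)
Lemma path_form_le (p : nat) (x : nat -> R) :
  2 * (\sum_(i < p) `|x i| * `|x i.+1|) <=
  2 * cos (pi / p.+2%:R) * \sum_(i < p.+1) x i ^+ 2.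
Proof.
have := @path_form_le_aux p.+2 x p (ltnSn _).
by rewrite [p.+2%:R * _]mulrCA divff ?pnatr_eq0 // mulr1 sinpi mul0r mulr0 addr0.
Qed.

(** The term [x 0 ^+ 2] is the jump from a zero left end, and [x p.+1 = 0] is the right end. The
    form is twice the sum of squares minus twice the sum of neighbour products, and the absolute
    bound on the latter serves both sides. *)
Lemma path_difference_bounds (p : nat) (x : nat -> R) : x p.+1 = 0 ->
  (2 - 2 * cos (pi / p.+2%:R)) * (\sum_(i < p.+1) x i ^+ 2) <=
  x 0%N ^+ 2 + \sum_(i < p.+1) (x i.+1 - x i) ^+ 2 <=
  (2 + 2 * cos (pi / p.+2%:R)) * (\sum_(i < p.+1) x i ^+ 2).
Proof.
move=> xp; set D := x 0%N ^+ 2 + _.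
have DE : D = 2 * (\sum_(i < p.+1) x i ^+ 2) - 2 * (\sum_(i < p) x i * x i.+1).
  rewrite /D; under eq_bigr do rewrite sqrrB.
  have -> : \sum_(i < p.+1) (x i.+1 ^+ 2 - x i.+1 * x i *+ 2 + x i ^+ 2) =
      \sum_(i < p.+1) x i.+1 ^+ 2 - 2 * (\sum_(i < p.+1) x i * x i.+1)
      + \sum_(i < p.+1) x i ^+ 2.
    rewrite mulr_sumr -sumrB -big_split; apply: eq_bigr => i _ /=; ring.
  have : x 0%N ^+ 2 + \sum_(i < p.+1) x i.+1 ^+ 2 = \sum_(i < p.+1) x i ^+ 2.
    have : \sum_(i < p.+2) x i ^+ 2 = \sum_(i < p.+1) x i ^+ 2.
      by rewrite big_ord_recr /= xp expr0n addr0.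
    by rewrite big_ord_recl.
  rewrite [\sum_(i < p.+1) x i * _]big_ord_recr /= xp mulr0 addr0; lra.
have := path_form_le p x.
have : `|\sum_(i < p) x i * x i.+1| <= \sum_(i < p) `|x i| * `|x i.+1|.
  by apply: le_trans (ler_norm_sum _ _ _) _; apply: ler_sum => i _; rewrite normrM.
rewrite ler_norml DE => /andP[lo hi] form; apply/andP; split; lra.
Qed.

End PathSpectrum.

(** * The consensus operator as the incidence matrix of a path *)

Lemma dot_mulmx (R : realType) (p q n : nat) (B : 'M[R]_(p, q)) u (v : 'M[R]_(q, n)) :
  dot u (B *m v) = dot (B^T *m u) v.
Proof.
have dotE k l (a b : 'M[R]_(k, l)) : dot a b = \tr (a^T *m b).
  rewrite /dot exchange_big; apply: eq_bigr => j _.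
  by rewrite mxE; apply: eq_bigr => i _; rewrite mxE.
by rewrite !dotE trmx_mul trmxK mulmxA.
Qed.

Section Consensus.
Context {R : realType}.

(** Rows are the edges of the path on [m] vertices; [incidence m *m (incidence m)^T] is tridiagonal
    with 2 on the diagonal and -1 beside it. *)
Definition incidence (m : nat) : 'M[R]_(m.-1, m) :=
  \matrix_(i, j) ((link_head i == j)%:R - (link_tail i == j)%:R).

Lemma sum_indicator (k : nat) (i : 'I_k) (F : 'I_k -> R) : \sum_j (i == j)%:R * F j = F i.
Proof.
rewrite (bigD1 i) //= eqxx mul1r big1 ?addr0 // => j.
by rewrite eq_sym => /negPf ->; rewrite mul0r.
Qed.

Lemma consensus_opE (m n : nat) (y : 'M[R]_(m, n)) :
  consensus_op y = incidence m *m y.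
Proof.
apply/matrixP => i c; rewrite !mxE.
under [RHS]eq_bigr do rewrite mxE mulrBl.
by rewrite sumrB !sum_indicator.
Qed.

Lemma sum_nat_indicator (N k : nat) (x : nat -> R) :
  \sum_(i < N) (i == k :> nat)%:R * x i = if (k < N)%N then x k else 0.
Proof.
case: ltnP => [kN|Nk]; last first.
  by rewrite big1 // => i _; rewrite ltn_eqF ?mul0r // (leq_trans _ Nk).
rewrite (bigD1 (Ordinal kN)) //= eqxx mul1r big1 ?addr0 // => i.
by rewrite -val_eqE => /negPf ->; rewrite mul0r.
Qed.

Lemma incidence_tr_bounds (m n : nat) (d : 'M[R]_(m.-1, n)) : (2 <= m)%N ->
  (2 - 2 * cos (pi / m%:R)) * dot d d <=
  dot ((incidence m)^T *m d) ((incidence m)^T *m d) <=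
  (2 + 2 * cos (pi / m%:R)) * dot d d.
Proof.
case: m d => [|[|p]] //= d _.
(* The columns decouple. Each is extended by zero, which supplies the right Dirichlet end
   [x c p.+1 = 0]. *)
pose x c k : R := if (k < p.+1)%N then d (inord k) c else 0.
have xE c (i : 'I_p.+1) : d i c = x c i by rewrite /x ltn_ord inord_val.
(* Vertex [j] heads edge [j] and ends edge [j - 1]; the first vertex has no preceding edge, whence
   the case split. *)
have entryE c (j : 'I_p.+2) : ((incidence p.+2)^T *m d) j c =
    x c j - (if j == 0%N :> nat then 0 else x c j.-1).
  rewrite mxE; under eq_bigr do rewrite !mxE mulrBl -!val_eqE /= xE.
  rewrite sumrB sum_nat_indicator; congr (_ - _).
    by case: ltnP => // pj; rewrite /x ltnNge pj.
  case: j => -[|j] jp /=; first by rewrite big1 // => i _; rewrite mul0r.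
  by under eq_bigr do rewrite eqSS; rewrite sum_nat_indicator -ltnS jp.
have dE : dot d d = \sum_c \sum_(i < p.+1) x c i ^+ 2.
  rewrite /dot exchange_big; apply: eq_bigr => c _; apply: eq_bigr => i _.
  by rewrite xE.
have -> : dot ((incidence p.+2)^T *m d) ((incidence p.+2)^T *m d) =
    \sum_c (x c 0%N ^+ 2 + \sum_(i < p.+1) (x c i.+1 - x c i) ^+ 2).
  rewrite /dot exchange_big; apply: eq_bigr => c _.
  rewrite big_ord_recl entryE /= subr0; congr (_ + _).
  by apply: eq_bigr => i _; rewrite entryE.
rewrite dE !mulr_sumr.
have xp c : x c p.+1 = 0 by rewrite /x ltnn.
by apply/andP; split; apply: ler_sum => c _; case/andP: (path_difference_bounds (xp c)).
Qed.

End Consensus.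

(** * Dual function *)

(** This replaces letting [t] tend to 0: if [a < E], then [t = (E - a) / (2 E)] turns [(1 - t) E]
    into the midpoint of [a] and [E], which exceeds [a]. *)
Lemma le_of_shrinking (R : realFieldType) (a E : R) :
  0 <= a -> (forall t, 0 < t < 1 -> (1 - t) * E <= a) -> E <= a.
Proof.
move=> a_ge0 shrink; rewrite leNgt; apply/negP => aE.
have E_gt0 : 0 < E by exact: le_lt_trans aE.
have := shrink ((E - a) / (2 * E)).
rewrite divr_gt0 ?subr_gt0 ?mulr_gt0 // ltr_pdivrMr ?mulr_gt0 // mul1r.
have -> : (1 - (E - a) / (2 * E)) * E = (E + a) / 2 by field; rewrite gt_eqF.
by move=> /(_ _) H; have : (E + a) / 2 <= a; [apply: H; lra | lra].
Qed.

Section Dual.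
Context {R : realType} {m n : nat}.
Context (f : 'I_m -> 'rV[R]_n -> R).
Implicit Types (lam d : 'M[R]_(m.-1, n)) (y z v r : 'M[R]_(m, n)).

Local Notation argmin := (is_argmin [set: 'rV[R]_n] f).
Local Notation g := (dual_function [set: 'rV[R]_n] f).
Local Notation A := consensus_op.
Local Notation B := (incidence m).

Lemma argmin_le lam y z : argmin lam y -> lagrangian f lam y <= lagrangian f lam z.
Proof. by case=> _; apply. Qed.

Lemma dual_function_le lam z : (g lam <= (lagrangian f lam z)%:E)%E.
Proof. by apply: ereal_inf_lbound; exists z. Qed.

Lemma dual_function_argmin lam y : argmin lam y -> g lam = (lagrangian f lam y)%:E.
Proof.
move=> ylam; apply/eqP; rewrite eq_le dual_function_le.
by apply: le_ereal_inf_tmp => _ [z _ <-]; rewrite lee_fin; exact: argmin_le.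
Qed.

Lemma lagrangian_shift lam d y : lagrangian f (lam + d) y = lagrangian f lam y + dot d (A y).
Proof. by rewrite /lagrangian dotDl addrA. Qed.

Lemma dot_consensus d y z : dot d (A z) = dot d (A y) + dot (B^T *m d) (z - y).
Proof. by rewrite -dot_mulmx -dotDr !consensus_opE -mulmxDr addrC subrK. Qed.

(** Minimality of [y] against [t z + (1 - t) y], combined with strong convexity and divided by [t],
    gives the bound with an extra factor [1 - t], which is then removed. No gradient is involved. *)
Lemma lagrangian_lower (mu : R) lam y z :
  (forall i, exists2 s, mu <= s & strongly_convex s (f i)) -> argmin lam y ->
  lagrangian f lam y + mu / 2 * dot (z - y) (z - y) <= lagrangian f lam z.
Proof.
move=> f_conv ylam; rewrite -lerBrDl.
apply: le_of_shrinking => [|t /andP[t0 t1]]; first by rewrite subr_ge0 argmin_le.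
rewrite -(ler_pM2l t0).
have := argmin_le (t *: z + (1 - t) *: y) ylam.
have : \sum_i f i (row i (t *: z + (1 - t) *: y)) <= t * (\sum_i f i (row i z)) +
    (1 - t) * (\sum_i f i (row i y)) - mu / 2 * (t * (1 - t)) * dot (z - y) (z - y).
  rewrite dot_rows !mulr_sumr -big_split -sumrB; apply: ler_sum => i _ /=.
  have [s mus /strongly_convex_ineq cvx] := f_conv i.
  have -> : row i (t *: z + (1 - t) *: y) = t *: row i z + (1 - t) *: row i y.
    by rewrite linearD !linearZ.
  have -> : row i (z - y) = row i z - row i y by rewrite linearB.
  have t01 : 0 <= t <= 1 by rewrite !ltW.
  apply: le_trans (cvx (row i z) (row i y) t t01) _.
  rewrite lerD2l lerN2; apply: ler_wpM2r (dot_ge0 _) _ _ _.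
  by apply: ler_wpM2r; rewrite ?ler_pM2r // mulr_ge0 ?subr_ge0 ?ltW.
rewrite /lagrangian !consensus_opE mulmxDr -!scalemxAr !dot_linear; lra.
Qed.

Lemma lagrangian_upper (L : R) lam y z :
  (forall i x, differentiable (f i) x) ->
  (forall i, exists2 s, 0 < s <= L & lipschitz_euclidean s (gradient (f i))) ->
  0 < L -> argmin lam y ->
  lagrangian f lam z <= lagrangian f lam y + L / 2 * dot (z - y) (z - y).
Proof.
move=> f_diff f_lip L_gt0 ylam.
(* [G] is the gradient of the Lagrangian in the primal variable at [y]. *)
pose G := \matrix_i gradient (f i) (row i y) + B^T *m lam.
have expansion v : lagrangian f lam (y + v) <=
    lagrangian f lam y + dot G v + L / 2 * dot v v.
  have : \sum_i f i (row i (y + v)) <= \sum_i f i (row i y) +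
      dot (\matrix_i gradient (f i) (row i y)) v + L / 2 * dot v v.
    rewrite !(dot_rows _ v) mulr_sumr -!big_split; apply: ler_sum => i _ /=.
    have [s /andP[s0 sL] lip] := f_lip i; rewrite linearD rowK.
    apply: le_trans (descent_lemma _ _ (f_diff i) s0 lip) _.
    by rewrite lerD2l; apply: ler_wpM2r (dot_ge0 _) _ _ _; rewrite ler_pM2r.
  rewrite /lagrangian /G consensus_opE mulmxDr dotDr dotDl -consensus_opE.
  by rewrite (dot_mulmx B lam v); lra.
(* A nonzero [G] would let the step [- L^-1 G] lower the Lagrangian by at least [|G|^2 / (2 L)],
   against minimality. *)
clearbody G; have G0 : G = 0.
  apply/eqP; rewrite -dot_eq0 eq_le dot_ge0 andbT.
  have := le_trans (argmin_le _ ylam) (expansion (- L^-1 *: G)).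
  rewrite !dot_linear.
  have -> : L / 2 * (- L^-1 * (- L^-1 * dot G G)) = L^-1 * dot G G / 2.
    by field; rewrite gt_eqF.
  by move=> H; rewrite -(pmulr_rle0 _ (_ : 0 < L^-1)) ?invr_gt0 //; lra.
have := expansion (z - y); rewrite G0 addrC subrK.
by rewrite -(scale0r 0) dotZl mul0r addr0.
Qed.

(** Both models are compared at one nonzero displacement, the all-ones matrix, which exists because
    [m] and [n] are positive. *)
Lemma strong_convexity_le_lipschitz (mu L : R) lam y :
  (0 < m)%N -> (0 < n)%N ->
  (forall z, lagrangian f lam y + mu / 2 * dot (z - y) (z - y) <= lagrangian f lam z) ->
  (forall z, lagrangian f lam z <= lagrangian f lam y + L / 2 * dot (z - y) (z - y)) ->
  mu <= L.
Proof.
move=> m0 n0 lower upper; pose v : 'M[R]_(m, n) := const_mx 1.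
have v_gt0 : 0 < dot v v.
  rewrite lt_neqAle dot_ge0 andbT eq_sym dot_eq0.
  apply/eqP => /matrixP /(_ (Ordinal m0) (Ordinal n0)); rewrite !mxE.
  exact/eqP/oner_neq0.
have := le_trans (lower (v + y)) (upper (v + y)).
by rewrite addrK lerD2l ler_pM2r // ler_pM2r.
Qed.

Local Notation c := (cos (pi / m%:R)).

(** With [b = z - y], the lower model plus the new linear term is bounded below by completing the
    square [|B^T d + mu b|^2]; the upper spectral bound then controls [|B^T d|^2]. As [z] is
    arbitrary, the bound reaches the minimiser at [lam + d]. *)
Lemma dual_smooth (mu : R) lam d y z :
  (2 <= m)%N -> 0 < mu ->
  (forall z, lagrangian f lam y + mu / 2 * dot (z - y) (z - y) <= lagrangian f lam z) ->
  lagrangian f lam y + dot d (A y) - 1 / mu * (2 + 2 * c) / 2 * dot d d <=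
  lagrangian f (lam + d) z.
Proof.
move=> m_ge2 mu0 lower; rewrite lagrangian_shift (dot_consensus d y z).
have := lower z; move: (z - y) => b.
have /andP[_ hi] := incidence_tr_bounds d m_ge2.
have := dot_ge0 (B^T *m d + mu *: b); rewrite !dot_linear (dotC b).
move: hi; set N := dot (B^T *m d) (B^T *m d) => hi sq.
have {}hi : 1 / mu * N / 2 <= 1 / mu * (2 + 2 * c) / 2 * dot d d.
  by rewrite [leRHS]mulrAC ler_pM2r // -[leRHS]mulrA ler_pM2l ?divr_gt0.
suff : 0 <= 1 / mu * N / 2 + dot (B^T *m d) b + mu / 2 * dot b b by lra.
rewrite -(pmulr_rge0 _ (_ : 0 < 2 * mu)) ?mulr_gt0 //.
have -> : 2 * mu * (1 / mu * N / 2 + dot (B^T *m d) b + mu / 2 * dot b b) =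
    N + 2 * mu * dot (B^T *m d) b + mu ^+ 2 * dot b b.
  by field; rewrite gt_eqF.
lra.
Qed.

(* The point [z = y - L^-1 B^T d] minimises the quadratic upper model of the
   Lagrangian at [lam + d]. *)
Lemma dual_polyak_lojasiewicz (L : R) lam d y :
  (2 <= m)%N -> 0 < L ->
  (forall z, lagrangian f lam z <= lagrangian f lam y + L / 2 * dot (z - y) (z - y)) ->
  (g (lam + d) <= (lagrangian f lam y +
    dot (A y) (A y) / (2 * (1 / L * (2 - 2 * c))))%:E)%E.
Proof.
move=> m_ge2 L0 upper; pose z := y - L^-1 *: (B^T *m d).
apply: le_trans (dual_function_le _ z) _; rewrite lee_fin.
rewrite lagrangian_shift (dot_consensus d y z).
have := upper z; have -> : z - y = - L^-1 *: (B^T *m d) by rewrite /z addrAC subrr add0r scaleNr.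
have /andP[lo _] := incidence_tr_bounds d m_ge2.
have /andP[_ c1] : 0 <= cos (pi / m%:R : R) < 1 by exact: cos_pi_div_bounds.
rewrite !dot_linear; set N := dot (B^T *m d) (B^T *m d) in lo *.
have -> : L / 2 * (- L^-1 * (- L^-1 * N)) = L^-1 * N / 2 by field; rewrite gt_eqF.
set mh := 1 / L * (2 - 2 * c).
have mh0 : 0 < mh by rewrite mulr_gt0 ?divr_gt0 //; lra.
have {}lo : mh * dot d d <= L^-1 * N.
  by rewrite /mh div1r -mulrA ler_pM2l ?invr_gt0.
(* The left side is concave in [d] with maximum at [A y / mh]; hence a bound free of [d], fit for
   comparison with an optimal multiplier. *)
suff : dot d (A y) - mh * dot d d / 2 <= dot (A y) (A y) / (2 * mh) by lra.
rewrite ler_pdivlMr; last by rewrite pmulr_rgt0.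
by have := dot_ge0 (A y - mh *: d); rewrite !dot_linear (dotC d (A y)); lra.
Qed.

Lemma consensus_sqr_le (e : 'I_m -> R) r : (forall i, enorm (row i r) <= e i) ->
  dot (A r) (A r) <= \sum_(i < m.-1) (e (link_head i) + e (link_tail i)) ^+ 2.
Proof.
move=> re; rewrite dot_rows; apply: ler_sum => i _; rewrite rowK -sqr_enorm.
rewrite ler_pXn2r ?nnegrE ?enorm_ge0 ?addr_ge0 ?(le_trans (enorm_ge0 _) (re _)) //.
by apply: le_trans (enorm_triangle _ _) _; rewrite enormN lerD.
Qed.

End Dual.

(** * Scalar recursion and limit superior *)

(** [C] is a fixed point of the affine recursion, so [u k - C] contracts by [q]; the term
    [- q ^+ k * C] is dropped at the end. *)
Lemma geometric_contraction (R : realDomainType) (q C : R) (u : nat -> R) :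
  0 <= q -> 0 <= C -> (forall k, u k.+1 <= q * u k + (1 - q) * C) ->
  forall k, u k <= q ^+ k * u 0%N + C.
Proof.
move=> q0 C0 ustep k; apply: (@le_trans _ _ (q ^+ k * (u 0%N - C) + C)); last first.
  by rewrite mulrBr -addrA lerD2l gerDr oppr_le0 mulr_ge0 ?exprn_ge0.
elim: k => [|k /(ler_wpM2l q0) IHk]; first by rewrite expr0 mul1r subrK.
by apply: le_trans (ustep k) _; rewrite exprS -mulrA; lra.
Qed.

(** The upper limit is an infimum of suprema over eventual index sets, so one set where the
    geometric term is below [e] suffices for each [e > 0]. *)
Lemma limn_esup_geometric (R : realType) (q a b : R) (u : nat -> \bar R) :
  0 <= q < 1 -> (forall k, u k <= (q ^+ k * a + b)%:E)%E -> (limn_esup u <= b%:E)%E.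
Proof.
move=> /andP[q0 q1] ub; apply/lee_addgt0Pr => e e0.
have qa : geometric a q @ \oo --> 0 by apply: cvg_geometric; rewrite ger0_norm.
have small := cvgr_lt 0 qa e e0.
apply: ge_ereal_inf; exists (ereal_sup (u @` [set k | geometric a q k < e])).
  by exists [set k | geometric a q k < e]; [exact: small|].
apply: ge_ereal_sup => _ [k /= ke <-]; apply: le_trans (ub k) _.
by rewrite -EFinD lee_fin addrC lerD2l mulrC ltW.
Qed.

(** * Contraction of the dual gap under bounded distortions *)

Theorem corollary2 (R : realType) (m n : nat) (hm : (2 <= m)%N) (hn : (1 <= n)%N)
    (f : 'I_m -> 'rV[R]_n -> R) (mus Ls : 'I_m -> R)
    (f_strict : forall i, strictly_convex (f i))
    (f_closed : forall i, closed_function (f i))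
    (mus_gt0 : forall i, 0 < mus i)
    (f_strong : forall i, strongly_convex (mus i) (f i))
    (f_diff : forall i x, differentiable (f i) x)
    (Ls_gt0 : forall i, 0 < Ls i)
    (f_lip : forall i, lipschitz_euclidean (Ls i) (gradient (f i)))
    (lamstar : 'M[R]_(m.-1, n))
    (lamstar_opt : dual_optimal [set: 'rV[R]_n] f lamstar)
    (gamma : R) (lam : nat -> 'M[R]_(m.-1, n)) (y r : nat -> 'M[R]_(m, n))
    (alg : inexact_dual_algorithm [set: 'rV[R]_n] f (fun=> gamma) lam y r)
    (epss : 'I_m -> R)
    (r_bound : forall i k, enorm (row i (r k)) <= epss i) :
  let i0 : 'I_m := Ordinal (ltnW hm) in
  let mu := \big[Num.min/mus i0]_(i < m) mus i in
  let L := \big[Num.max/Ls i0]_(i < m) Ls i in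
  let L_h := 1 / mu * (2 + 2 * cos (pi / m%:R)) in
  let mu_h := 1 / L * (2 - 2 * cos (pi / m%:R)) in
  let eps := Num.sqrt (\sum_(i < m.-1)
    (epss (link_head i) + epss (link_tail i)) ^+ 2) in
  let h := fun l => (- dual_function [set: 'rV[R]_n] f l)%E in
  0 < gamma <= 1 / L_h ->
  (forall k : nat,
    (h (lam k) - h lamstar <=
      ((1 - gamma * mu_h) ^+ k)%:E * (h (lam 0%N) - h lamstar)
      + (eps ^+ 2 / (2 * mu_h))%:E)%E) /\
  (limn_esup (fun k => h (lam k) - h lamstar)%E <=
    (eps ^+ 2 / (2 * mu_h))%:E)%E.
Proof.
move=> i0 mu L L_h mu_h eps h /andP[gamma_gt0 gammaLh].
have m_gt0 : (0 < m)%N by exact: ltnW.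
have mu_gt0 : 0 < mu by apply: lt_bigmin.
have mu_le i : mu <= mus i by exact: bigmin_le.
have L_ge i : Ls i <= L by exact: le_bigmax.
have L_gt0 : 0 < L by exact: lt_le_trans (Ls_gt0 i0) (L_ge i0).
have /andP[c_ge0 c_lt1] : 0 <= cos (pi / m%:R : R) < 1 by exact: cos_pi_div_bounds.
have y_argmin k : is_argmin [set: 'rV[R]_n] f (lam k) (y k) by case: (alg k).
have lower k z : lagrangian f (lam k) (y k) + mu / 2 * dot (z - y k) (z - y k) <=
    lagrangian f (lam k) z.
  by apply: lagrangian_lower (y_argmin k) => i; exists (mus i).
have upper k z : lagrangian f (lam k) z <=
    lagrangian f (lam k) (y k) + L / 2 * dot (z - y k) (z - y k).
  by apply: lagrangian_upper (y_argmin k) => // i; exists (Ls i); rewrite ?Ls_gt0 ?L_ge.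
(* This yields [mu_h <= L_h], hence a nonnegative contraction factor [1 - gamma * mu_h]. *)
have mu_le_L : mu <= L.
  exact: strong_convexity_le_lipschitz m_gt0 hn (lower 0%N) (upper 0%N).
have mu_h_gt0 : 0 < mu_h by rewrite mulr_gt0 ?divr_gt0 //; lra.
have L_h_gt0 : 0 < L_h by rewrite mulr_gt0 ?divr_gt0 //; lra.
have mu_h_le : mu_h <= L_h.
  apply: ler_pM; [by rewrite divr_ge0 // ltW | lra | | lra].
  by rewrite !div1r lef_pV2 ?posrE.
have gammaL_le1 : gamma * L_h <= 1 by rewrite -ler_pdivlMr.
pose g k := lagrangian f (lam k) (y k).
have gE k : dual_function [set: 'rV[R]_n] f (lam k) = (g k)%:E.
  exact: dual_function_argmin.
(* The optimal dual value is finite: any Lagrangian value bounds it above, and optimality against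
   [lam 0] bounds it below. *)
have [gs gsE] : exists gs, dual_function [set: 'rV[R]_n] f lamstar = gs%:E.
  have := lamstar_opt (lam 0%N); rewrite gE.
  have := dual_function_le f lamstar (y 0%N).
  by case: (dual_function _ _ _) => [gs _ _| |] //; exists gs.
have hE k : (h (lam k) - h lamstar = (gs - g k)%:E)%E.
  by rewrite /h gE gsE -EFinN -EFinN -EFinB opprK addrC.
have eps_sq : eps ^+ 2 = \sum_(i < m.-1) (epss (link_head i) + epss (link_tail i)) ^+ 2.
  by rewrite sqr_sqrtr // sumr_ge0 // => i _; exact: sqr_ge0.
have C_ge0 : 0 <= eps ^+ 2 / (2 * mu_h) by rewrite divr_ge0 ?sqr_ge0 // mulr_ge0 // ltW.
have q_ge0 : 0 <= 1 - gamma * mu_h.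
  by rewrite subr_ge0 (le_trans _ gammaL_le1) // ler_pM2l.
(* With [a = A y] and [b = A r], smoothness and [gamma * L_h <= 1] give an ascent of at least [gamma
   <a + b, a> - gamma / 2 |a + b|^2 = gamma / 2 (|a|^2 - |b|^2)]. The Polyak-Lojasiewicz inequality
   bounds [|a|^2] below by [2 mu_h] times the gap, and [|b|^2 <= eps^2]. *)
have step k : gs - g k.+1 <=
    (1 - gamma * mu_h) * (gs - g k) + (1 - (1 - gamma * mu_h)) * (eps ^+ 2 / (2 * mu_h)).
  have [_ lamS] := alg k.
  have := dual_smooth (gamma *: consensus_op (y k + r k)) (y k.+1) hm mu_gt0 (lower k).
  rewrite -lamS -/(g k) -/(g k.+1) -/L_h.
  have := dual_polyak_lojasiewicz (lamstar - lam k) hm L_gt0 (upper k).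
  rewrite addrC subrK gsE lee_fin -/(g k) -/mu_h -lerBlDl ler_pdivlMr; last first.
    by rewrite pmulr_rgt0.
  have := consensus_sqr_le (fun i => r_bound i k); rewrite -eps_sq.
  rewrite !consensus_opE mulmxDr; set a := incidence m *m y k; set b := incidence m *m r k.
  have -> : (1 - (1 - gamma * mu_h)) * (eps ^+ 2 / (2 * mu_h)) = gamma * eps ^+ 2 / 2.
    by field; rewrite gt_eqF.
  move: a b => a b; rewrite !dot_linear (dotC b a).
  set aa := dot a a; set bb := dot b b; set ab := dot a b.
  move=> /(ler_wpM2l (ltW gamma_gt0)) b_le /(ler_wpM2l (ltW gamma_gt0)) pl.
  have sq_ge0 : 0 <= aa + 2 * ab + bb.
    by have := dot_ge0 (a + b); rewrite !dot_linear (dotC b a) -/aa -/bb -/ab; lra.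
  have := ler_wpM2r (mulr_ge0 (ltW gamma_gt0) sq_ge0) gammaL_le1.
  lra.
have bound := geometric_contraction q_ge0 C_ge0 step.
split=> [k|]; first by rewrite !hE -EFinM -EFinD lee_fin.
apply: (@limn_esup_geometric _ (1 - gamma * mu_h) (gs - g 0%N)) => [|k].
  by rewrite q_ge0 gtrBl mulr_gt0.
by rewrite hE lee_fin.
Qed.
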